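(* Let $\{a_1,\dots,a_n\}$ and $\{a'_1,\dots,a'_m\}$ be two sets of distinct complex numbers, put $a=(a_1,\dots,a_n)$, $a'=(a'_1,\dots,a'_m)$, and let $\psi:\mathscr{V}_a\to\mathscr{V}_{a'}$ be an isomorphism of Lie algebras. Then $m=n$ and one of the following two cases holds: (a) There exists a nonzero constant $c\in\mathbb{C}$ such that, after reordering the $a'_i$ if necessary, $a_i-a_1=c(a'_i-a'_1)$ and $\psi((t-a_i)^{k}\partial)=c^{k-1}(t-a'_i)^{k}\partial$ for all $k\in\mathbb{Z}$ and $i=1,\dots,n$. (b) There exists a nonzero constant $c\in\mathbb{C}$ such that, after reordering the $a_i$ and the $a'_i$ if necessary, $(a_i-a_1)(a'_i-a'_1)=c$ for all $i\neq 1$, and for all $k\in\mathbb{Z}$ $$\psi((t-a_1)^k\partial)=\frac{-c^{k-1}}{(t-a'_1)^{k-2}}\,\partial,\qquad \psi((t-a_i)^k\partial)=\frac{-(a_1-a_i)^k(t-a'_i)^k}{c\,(t-a'_1)^{k-2}}\,\partial\quad\text{for all } i>1.$$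
   Context: All algebras are over $\mathbb{C}$ and $n,m\ge 1$. For a tuple $a=(a_1,\dots,a_n)$ of distinct complex numbers, $R_a$ is the subalgebra of $\mathbb{C}(t)$ generated by $t,(t-a_1)^{-1},\dots,(t-a_n)^{-1}$, and $\mathscr{V}_a=\operatorname{Der}(R_a)=R_a\partial$ with $\partial=d/dt$, a Lie algebra with bracket $[f\partial,g\partial]=(f\partial(g)-g\partial(f))\partial$. *)

(* Defs.v *)
From HB Require Import structures.
From mathcomp Require Import all_boot all_order all_algebra.
From mathcomp Require Import mathcomp_extra boolp classical_sets functions.
From mathcomp Require Import ring.

Set Implicit Arguments.
Unset Strict Implicit.
Unset Printing Implicit Defensive.

Import GRing.Theory.
Local Open Scope quotient_scope.

Local Open Scope classical_set_scope.
Local Open Scope ring_scope.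

Notation ratfun K := {fraction {poly K}}.

Section RationalFunctions.
Variable K : fieldType.

Local Notation ratfun := (ratfun K).
Local Notation "p %:F" := (@FracField.tofrac {poly K} p).

Definition ratfun_scale (c : K) (f : ratfun) : ratfun := c%:P%:F * f.

Lemma ratfun_scaleA c d f :
  ratfun_scale c (ratfun_scale d f) = ratfun_scale (c * d) f.
Proof. by rewrite /ratfun_scale polyCM rmorphM mulrA. Qed.

Lemma ratfun_scale1 : left_id 1 ratfun_scale.
Proof. by move=> f; rewrite /ratfun_scale polyC1 rmorph1 mul1r. Qed.

Lemma ratfun_scaleDr : right_distributive ratfun_scale +%R.
Proof. by move=> c f g; rewrite /ratfun_scale mulrDr. Qed.

Lemma ratfun_scaleDl f : {morph ratfun_scale^~ f : c d / c + d}.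
Proof. by move=> c d; rewrite /ratfun_scale polyCD rmorphD mulrDl. Qed.

HB.instance Definition _ := GRing.Zmodule_isLmodule.Build K ratfun
  ratfun_scaleA ratfun_scale1 ratfun_scaleDr ratfun_scaleDl.

Lemma ratfun_scaleE c f : c *: f = c%:P%:F * f.
Proof. by []. Qed.

Lemma ratfun_scaleAl c (f g : ratfun) : c *: (f * g) = c *: f * g.
Proof. by rewrite !ratfun_scaleE mulrA. Qed.

HB.instance Definition _ :=
  GRing.Lmodule_isLalgebra.Build K ratfun ratfun_scaleAl.

Lemma ratfun_scaleAr c (f g : ratfun) : c *: (f * g) = f * (c *: g).
Proof. by rewrite !ratfun_scaleE mulrCA. Qed.

HB.instance Definition _ := GRing.Lalgebra_isAlgebra.Build K ratfun ratfun_scaleAr.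

Definition ratT : ratfun := 'X%:F.

(* d/dt by the quotient rule; ratderivE shows that the choice of the
   representative made by repr is immaterial. *)
Definition ratderiv (f : ratfun) : ratfun :=
  let r := repr f in
  let p := \n_r in let q := \d_r in
  (p^`() * q - p * q^`())%:F / (q ^+ 2)%:F.

Lemma ratfun_repr (f : ratfun) :
  let r := repr f in
  f = (\n_r)%:F / (\d_r)%:F.
Proof.
move=> r.
have dr0 : (\d_r)%:F != 0 by rewrite tofrac_eq0 denom_ratioP.
apply: (canRL (mulfK dr0)).
rewrite -[f in LHS](reprK f) -/r.
change (FracField.mul (\pi_(ratfun) r) (FracField.tofrac \d_r) = FracField.tofrac \n_r).
rewrite !piE; apply/eqmodP; rewrite /= FracField.equivfE /FracField.mulf.
by rewrite !numden_Ratio ?oner_eq0 ?mulr1 ?denom_ratioP // mulrC.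
Qed.

Lemma ratderivE (p q : {poly K}) : q != 0 ->
  ratderiv (p%:F / q%:F) =
  (p^`() * q - p * q^`())%:F / (q ^+ 2)%:F.
Proof.
set f := _ / _ => q0; rewrite /ratderiv.
have := ratfun_repr f; rewrite /=.
have := denom_ratioP (repr f).
move: (\n__) (\d__) => p1 q1 q10 /eqP.
rewrite {}/f eqr_div ?tofrac_eq0 // -!rmorphM -subr_eq0 -rmorphB.
rewrite tofrac_eq0 subr_eq0 => /eqP E.
apply/eqP; rewrite eqr_div ?tofrac_eq0 ?expf_neq0 // -!rmorphM.
rewrite -subr_eq0 -rmorphB tofrac_eq0 subr_eq0; apply/eqP.
have E' := congr1 (@deriv K) E; rewrite !derivM in E'.
apply/eqP; rewrite -subr_eq0; apply/eqP.
pose u := p^`() * q1 + p * q1^`() - (p1^`() * q + p1 * q^`()).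
have u0 : u = 0 by rewrite /u E' subrr.
have v0 : p * q1 - p1 * q = 0 by rewrite E subrr.
transitivity (- (u * q * q1) + (p * q1 - p1 * q) * (q1^`() * q + q^`() * q1));
  last by rewrite u0 v0 !mul0r oppr0 addr0.
rewrite /u; ring.
Qed.

Lemma ratderiv_poly (p : {poly K}) :
  ratderiv (p%:F) = (p^`())%:F.
Proof.
rewrite -[p%:F]divr1 -tofrac1 ratderivE ?oner_eq0 //.
by rewrite derivC mulr0 subr0 mulr1 expr1n rmorph1 divr1.
Qed.

Lemma ratderivT : ratderiv ratT = 1.
Proof. by rewrite /ratT ratderiv_poly derivX rmorph1. Qed.

Lemma ratderiv_div (p q : {poly K}) : q != 0 ->
  ratderiv (p%:F / q%:F) =
  ((p^`())%:F * q%:F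
     - p%:F * (q^`())%:F) / q%:F ^+ 2.
Proof.
move=> q0; rewrite (ratderivE p q0) expr2 tofracM; congr (_ / _).
by rewrite rmorphB -!tofracM.
Qed.

Lemma ratfun_split (f : ratfun) : exists p q : {poly K},
  q != 0 /\ f = p%:F / q%:F.
Proof.
exists (\n_(repr f)), (\d_(repr f)).
by split; [exact: denom_ratioP | exact: ratfun_repr].
Qed.

Fact quotient_ruleD (F : fieldType) (p q r s p' q' r' s' : F) :
  q != 0 -> s != 0 ->
  ((p' * s + p * s' + (r' * q + r * q')) * (q * s)
     - (p * s + r * q) * (q' * s + q * s')) / (q * s) ^+ 2
  = (p' * q - p * q') / q ^+ 2 + (r' * s - r * s') / s ^+ 2.
Proof. by move=> q0 s0; field; apply/andP. Qed.

Fact quotient_ruleM (F : fieldType) (p q r s p' q' r' s' : F) :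
  q != 0 -> s != 0 ->
  ((p' * r + p * r') * (q * s) - p * r * (q' * s + q * s')) / (q * s) ^+ 2
  = (p' * q - p * q') / q ^+ 2 * (r / s) + p / q * ((r' * s - r * s') / s ^+ 2).
Proof. by move=> q0 s0; field; apply/andP. Qed.

Lemma ratderivD (f g : ratfun) : ratderiv (f + g) = ratderiv f + ratderiv g.
Proof.
have [p [q [q0 ->]]] := ratfun_split f.
have [r [s [s0 ->]]] := ratfun_split g.
have q0' : q%:F != 0 by rewrite tofrac_eq0.
have s0' : s%:F != 0 by rewrite tofrac_eq0.
have -> : p%:F / q%:F
          + r%:F / s%:F
        = (p * s + r * q)%:F / (q * s)%:F.
  rewrite (tofracD (p * s)) (tofracM p) (tofracM r).
  rewrite (tofracM q).
  exact: (addf_div _ _ q0' s0').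
rewrite (ratderiv_div _ (mulf_neq0 q0 s0)) (ratderiv_div p q0) (ratderiv_div r s0).
rewrite derivD !derivM !tofracD !tofracM.
exact: (quotient_ruleD _ _ _ _ _ _ q0' s0').
Qed.

Lemma ratderivM (f g : ratfun) :
  ratderiv (f * g) = ratderiv f * g + f * ratderiv g.
Proof.
have [p [q [q0 ->]]] := ratfun_split f.
have [r [s [s0 ->]]] := ratfun_split g.
have q0' : q%:F != 0 by rewrite tofrac_eq0.
have s0' : s%:F != 0 by rewrite tofrac_eq0.
have -> : p%:F / q%:F
          * (r%:F / s%:F)
        = (p * r)%:F / (q * s)%:F.
  by rewrite (tofracM p) (tofracM q) mulf_div.
rewrite (ratderiv_div _ (mulf_neq0 q0 s0)) (ratderiv_div p q0) (ratderiv_div r s0).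
rewrite !derivM !tofracD !tofracM.
exact: (quotient_ruleM _ _ _ _ _ _ q0' s0').
Qed.

Lemma ratderivC (c : K) : ratderiv c%:A = 0.
Proof. by rewrite ratfun_scaleE mulr1 ratderiv_poly derivC rmorph0. Qed.

Lemma ratderivZ (c : K) (f : ratfun) : ratderiv (c *: f) = c *: ratderiv f.
Proof. by rewrite -mulr_algl ratderivM ratderivC mul0r add0r mulr_algl. Qed.

Lemma ratderivV (f : ratfun) : f != 0 ->
  ratderiv f^-1 = - (ratderiv f * (f^-1 * f^-1)).
Proof.
move=> f0; have := ratderivM f f^-1; have := ratderivC 1.
rewrite divff // scale1r => -> /esym/eqP.
rewrite addrC addr_eq0 => /eqP E; apply: (mulfI f0).
by rewrite E mulrN mulrCA mulVKf // mulrC.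
Qed.

Lemma ratT_neqC (x : K) : ratT - x%:A != 0.
Proof.
by rewrite ratfun_scaleE mulr1 -tofracB tofrac_eq0 polyXsubC_eq0.
Qed.

End RationalFunctions.

Arguments ratT {K}.

Section Subalgebra.
Variables (K : fieldType) (A : algType K) (X : set A).

Definition subalg_gen : set A :=
  smallest (fun S : set A => GRing.subalg_closed [in S]) X.

Lemma subalg_gen_closed : GRing.subalg_closed [in subalg_gen].
Proof.
split=> [|c f g|f g]; rewrite ?inE.
- by move=> S [[S1 _ _] _]; move: S1; rewrite inE.
- move=> Hf Hg S SX; case: (SX) => -[_ SZ _] _.
  by have := SZ c f g; rewrite !inE; apply; [apply: Hf | apply: Hg].
- move=> Hf Hg S SX; case: (SX) => -[_ _ SM] _.
  by have := SM f g; rewrite !inE; apply; [apply: Hf | apply: Hg].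
Qed.

End Subalgebra.

Section Ra.
Variables (K : fieldType) (a : seq K).

Definition Ra_set : set (ratfun K) :=
  subalg_gen ([set ratT] `|` [set (ratT - x%:A)^-1 | x in [set` a]]).

Definition Ra_pred : {pred ratfun K} := [in Ra_set].

HB.instance Definition _ := GRing.isSubalgClosed.Build K (ratfun K) Ra_pred
  (subalg_gen_closed _).

Definition Ra : Type := {f : ratfun K | f \in Ra_pred}.
HB.instance Definition _ := SubType.on Ra.
HB.instance Definition _ := Choice.on Ra.
HB.instance Definition _ := [SubChoice_isSubAlgebra of Ra by <:].
HB.instance Definition _ := [SubNzRing_isSubComNzRing of Ra by <:].

Lemma ratT_Ra : ratT \in Ra_pred.
Proof. by rewrite inE; apply: sub_gen_smallest; left. Qed.

Lemma ratTB_inv_Ra (x : K) : x \in a -> (ratT - x%:A)^-1 \in Ra_pred.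
Proof. by move=> ax; rewrite inE; apply: sub_gen_smallest; right; exists x. Qed.

Lemma ratderiv_Ra (f : ratfun K) : f \in Ra_pred -> ratderiv f \in Ra_pred.
Proof.
pose S : set (ratfun K) :=
  [set g | g \in Ra_pred /\ ratderiv g \in Ra_pred].
suff SR : Ra_set `<=` S by rewrite inE => /SR [].
apply: smallest_sub.
  split=> [|c g h|g h]; rewrite !inE /S /=.
  - have := ratderivC (1 : K); rewrite scale1r => ->.
    by split; [exact: rpred1 | exact: rpred0].
  - move=> [Rg Rg'] [Rh Rh']; rewrite ratderivD ratderivZ.
    by split; apply: rpredD => //; apply: rpredZ.
  - move=> [Rg Rg'] [Rh Rh']; rewrite ratderivM.
    by split; [apply: rpredM | apply: rpredD; apply: rpredM].
move=> g [->|[x ax <-]].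
  by split; [exact: ratT_Ra | rewrite ratderivT rpred1].
have Rx := ratTB_inv_Ra ax.
split; first exact: Rx.
rewrite (ratderivV (ratT_neqC x)).
have -> : ratderiv (ratT - x%:A) = 1.
  by rewrite ratderivD ratderivT -scaleNr ratderivC addr0.
by rewrite mul1r rpredN; apply: rpredM.
Qed.

(* R_a is only a unit ring: f^-1 is the inverse taken in K(t) when that lies
   in R_a, and f otherwise.  By tvarB_unit and val_tvarBX, the integer powers
   of t - x computed in R_a are those of K(t) when x is in a. *)
Definition Ra_unit : {pred Ra} :=
  [pred f : Ra | (f != 0) && ((val f)^-1 \in Ra_pred)].

Definition Ra_inv (f : Ra) : Ra := insubd f (val f)^-1.

Lemma Ra_mulVx : {in Ra_unit, left_inverse 1 Ra_inv *%R}.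
Proof.
move=> f /andP[f0 Rf]; apply: val_inj; rewrite rmorphM rmorph1 /= val_insubd Rf.
apply: mulVf; apply: contra f0 => /eqP f0; apply/eqP; apply: val_inj.
by rewrite rmorph0; exact: f0.
Qed.

Lemma Ra_unitPl f g : g * f = 1 -> Ra_unit f.
Proof.
move=> gf1; have gf1' : val g * val f = 1 by exact: (congr1 val gf1).
have f0 : val f != 0.
  by apply/eqP => f0; move/eqP: gf1'; rewrite f0 mulr0 eq_sym oner_eq0.
rewrite /Ra_unit /=; apply/andP; split.
  by apply: contra f0 => /eqP ->; rewrite rmorph0.
have -> : (val f)^-1 = val g by rewrite -[RHS](mulfK f0) gf1' mul1r.
exact: valP g.
Qed.

Lemma Ra_inv_out : {in [predC Ra_unit], Ra_inv =1 id}.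
Proof.
move=> f; rewrite !inE negb_and negbK => /orP[/eqP -> | Rf]; apply: val_inj.
  by rewrite val_insubd rmorph0 invr0; case: ifP.
by rewrite val_insubd (negbTE Rf).
Qed.

HB.instance Definition _ := GRing.ComNzRing_hasMulInverse.Build Ra
  Ra_mulVx Ra_unitPl Ra_inv_out.

Definition tvar : Ra := Sub ratT ratT_Ra.

Definition Ra_deriv (f : Ra) : Ra := Sub (ratderiv (val f)) (ratderiv_Ra (valP f)).

Lemma tvarB_unit (x : K) : x \in a -> tvar - x%:A \is a GRing.unit.
Proof.
move=> ax; have E : val (tvar - x%:A) = ratT - x%:A by rewrite rmorphB linearZ rmorph1.
apply/andP; split; last by rewrite E ratTB_inv_Ra.
by apply: contra (ratT_neqC x) => /eqP f0; rewrite -E f0 rmorph0.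
Qed.

Lemma val_tvarBX (x : K) (k : int) : x \in a ->
  val ((tvar - x%:A) ^ k) = (ratT - x%:A) ^ k.
Proof.
move=> ax; have E : val (tvar - x%:A) = ratT - x%:A by rewrite rmorphB linearZ rmorph1.
have EV : val (tvar - x%:A)^-1 = (ratT - x%:A)^-1.
  by rewrite /GRing.inv /= val_insubd E ratTB_inv_Ra.
case: k => n; first by rewrite -!exprnP -E; exact: rmorphXn.
by rewrite !NegzE -!exprnN -!exprVn -EV; exact: rmorphXn.
Qed.

End Ra.

Section Derivations.
Variables (K : fieldType) (A : comAlgType K).

Definition derivations : {pred (A -> A)} := [pred D : A -> A |
  `[< linear D /\ forall f g, D (f * g) = D f * g + f * D g >]].

Lemma derivations_submod_closed : submod_closed derivations.
Proof.
split=> [|c D E].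
  apply/asboolP; split=> [c f g|f g].
    by rewrite /GRing.zero /= scaler0 addr0.
  by rewrite /GRing.zero /= mul0r mulr0 addr0.
move=> /asboolP[Dl DM] /asboolP[El EM]; apply/asboolP.
split=> [d f g|f g].
  change ((c *: D (d *: f + g) + E (d *: f + g)) =
          d *: (c *: D f + E f) + (c *: D g + E g)).
  by rewrite Dl El !scalerDr !scalerA mulrC addrACA.
change (c *: D (f * g) + E (f * g) =
        (c *: D f + E f) * g + f * (c *: D g + E g)).
by rewrite DM EM scalerDr mulrDl mulrDr -scalerAl -scalerAr addrACA.
Qed.

HB.instance Definition _ := GRing.isSubmodClosed.Build K (A -> A) derivations
  derivations_submod_closed.

Definition Der : Type := {D : A -> A | D \in derivations}.
HB.instance Definition _ := SubType.on Der.
HB.instance Definition _ := Choice.on Der.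
HB.instance Definition _ := [SubChoice_isSubLmodule of Der by <:].

Definition Der_fun (D : Der) : A -> A := val D.
Coercion Der_fun : Der >-> Funclass.

Lemma DerP (D : Der) :
  linear D /\ forall f g, D (f * g) = D f * g + f * D g.
Proof. by have /asboolP := valP D. Qed.

Lemma Der_ext (D E : Der) : D =1 E -> D = E.
Proof. by move=> DE; apply: val_inj; apply/funext. Qed.

Lemma Der_bracket_subproof (D E : Der) :
  (fun f => D (E f) - E (D f)) \in derivations.
Proof.
have [Dl DM] := DerP D; have [El EM] := DerP E.
have DD f g : D (f + g) = D f + D g by rewrite -[f]scale1r Dl !scale1r.
have ED f g : E (f + g) = E f + E g by rewrite -[f]scale1r El !scale1r.
apply/asboolP; split=> [c f g|f g].
  by rewrite El Dl Dl El scalerBr opprD addrACA.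
by rewrite EM DM DD ED !DM !EM; ring.
Qed.

Definition Der_bracket (D E : Der) : Der :=
  Sub (fun f => D (E f) - E (D f)) (Der_bracket_subproof D E).

End Derivations.

Section VectorFields.
Variables (K : fieldType) (a : seq K).

Notation Va := (Der (Ra a)).

Lemma val_RaM (f g : Ra a) : val (f * g) = val f * val g.
Proof. by []. Qed.

Lemma Ra_derivD (f g : Ra a) : Ra_deriv (f + g) = Ra_deriv f + Ra_deriv g.
Proof. by apply: val_inj; exact: (ratderivD (val f) (val g)). Qed.

Lemma Ra_derivZ (c : K) (f : Ra a) : Ra_deriv (c *: f) = c *: Ra_deriv f.
Proof. by apply: val_inj; exact: (ratderivZ c (val f)). Qed.

Lemma Ra_derivM (f g : Ra a) :
  Ra_deriv (f * g) = Ra_deriv f * g + f * Ra_deriv g.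
Proof. by apply: val_inj; exact: (ratderivM (val f) (val g)). Qed.

Lemma vfield_subproof (f : Ra a) :
  (fun g => f * Ra_deriv g) \in derivations (A := Ra a).
Proof.
apply/asboolP; split=> [c g h|g h].
  by rewrite Ra_derivD Ra_derivZ mulrDr scalerAr.
by rewrite Ra_derivM mulrDr mulrA mulrCA.
Qed.

Definition vfield (f : Ra a) : Va :=
  Sub (fun g => f * Ra_deriv g) (vfield_subproof f).

Lemma vfieldE f g : vfield f g = f * Ra_deriv g.
Proof. by []. Qed.

Lemma vfield_bracket (f g : Ra a) :
  Der_bracket (vfield f) (vfield g) = vfield (f * Ra_deriv g - g * Ra_deriv f).
Proof.
apply: Der_ext => h.
change (f * Ra_deriv (g * Ra_deriv h) - g * Ra_deriv (f * Ra_deriv h) =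
        (f * Ra_deriv g - g * Ra_deriv f) * Ra_deriv h).
by rewrite !Ra_derivM; ring.
Qed.

Lemma Der_Ra_vfield (D : Va) : D = vfield (D (tvar a)).
Proof.
have [Dl DM] := DerP D.
have DD f g : D (f + g) = D f + D g by rewrite -[f]scale1r Dl !scale1r.
have D0 : D 0 = 0 by apply: (addrI (D 0)); rewrite -DD !addr0.
have DZ c f : D (c *: f) = c *: D f by rewrite -[c *: f]addr0 Dl D0 addr0.
have D1 : D 1 = 0.
  by apply: (addrI (D 1)); rewrite addr0 -[in RHS](mulr1 1) DM mulr1 mul1r.
pose P (x : Ra a) := D x = D (tvar a) * Ra_deriv x.
pose S : set (ratfun K) := [set g | exists2 x : Ra a, val x = g & P x].
suff SR : Ra_set a `<=` S.
  apply: Der_ext => x; have : S (val x) by apply: SR; rewrite -in_setE; exact: valP.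
  by case=> y /val_inj ->.
have Ra_deriv1 : Ra_deriv (1 : Ra a) = 0.
  by apply: val_inj; have := ratderivC (1 : K); rewrite scale1r.
have Ra_derivT : Ra_deriv (tvar a) = 1.
  by apply: val_inj; exact: ratderivT.
apply: smallest_sub.
  split=> [|c g h|g h]; rewrite !inE /S /=.
  - by exists 1; rewrite // /P D1 Ra_deriv1 mulr0.
  - move=> [x <- Px] [y <- Py]; exists (c *: x + y) => //.
    by rewrite /P Dl Px Py Ra_derivD Ra_derivZ mulrDr scalerAr.
  - move=> [x <- Px] [y <- Py]; exists (x * y) => //.
    by rewrite /P DM Px Py Ra_derivM mulrDr; ring.
move=> g [->|[x ax <-]].
  by exists (tvar a); rewrite // /P Ra_derivT mulr1.
have u := tvarB_unit ax; exists ((tvar a - x%:A)^-1).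
  by have := val_tvarBX (-1) ax; rewrite !exprN1.
move: u; set y := tvar a - x%:A => u.
have Py : P y.
  rewrite /P /y -scaleNr DD Ra_derivD DZ D1 Ra_derivZ Ra_deriv1 !scaler0 !addr0.
  by rewrite Ra_derivT mulr1.
have V (E : Ra a -> Ra a) : E 1 = 0 ->
    (forall f g, E (f * g) = E f * g + f * E g) -> E y^-1 = - (E y * (y^-1 * y^-1)).
  move=> E1 EM; have := EM y y^-1; rewrite divrr // E1 => /esym/eqP.
  rewrite addrC addr_eq0 => /eqP h; apply: (mulrI u).
  by rewrite h mulrN mulrCA mulVKr // mulrC.
rewrite /P (V D D1 DM) (V _ Ra_deriv1 Ra_derivM) Py mulrN.
by rewrite -[in LHS]mulrA.
Qed.

End VectorFields.

Definition is_lie_iso (K : fieldType) (A B : comAlgType K)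
    (psi : Der A -> Der B) : Prop :=
  [/\ linear psi, bijective psi &
      forall D E, psi (Der_bracket D E) = Der_bracket (psi D) (psi E)].

(* Main.v *)
(* A Lie isomorphism psi sends f d/dt to (u * phi f) d/dt, where u d/dt is the
   image of d/dt; preservation of the brackets with d/dt, t d/dt and t^2 d/dt
   makes phi multiplicative, and bijectivity of psi makes it an algebra
   isomorphism R_a -> R_a'.  Since phi t generates K(t), it is a fractional linear
   function of t.  The units of R_a of the form t - x are those with x in a, so phi
   permutes the poles accordingly; the two cases are whether infinity is fixed. *)

Require Import Defs.
From HB Require Import structures.
From mathcomp Require Import all_boot all_order all_algebra.
From mathcomp Require Import boolp classical_sets.
From mathcomp Require Import ring reals complex.

Import GRing.Theory Num.Theory.
Local Open Scope ring_scope.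

(** * From preserved Wronskians to an algebra isomorphism *)

(* With delta f = Psi (t f) - Psi t * Psi f, the brackets with 1, t and t^2 give
   delta (d f) = 0 and delta (t * d f) = 2 delta f; since t * d f = d (t f) - f,
   this forces 3 delta f = 0. *)
Lemma wronskian_hom_mulX (A : comNzRingType) (F : fieldType) (t : A)
    (d : A -> A) (D : F -> F) (Psi : A -> F) :
    2%:R != 0 :> F -> 3%:R != 0 :> F ->
    (forall f g, d (f * g) = d f * g + f * d g) ->
    d 1 = 0 -> d t = 1 -> D 1 = 0 -> D (Psi t) = 1 ->
    (forall f g, Psi (f - g) = Psi f - Psi g) -> Psi 1 = 1 ->
    (forall f g, Psi (f * d g - g * d f) = Psi f * D (Psi g) - Psi g * D (Psi f)) ->
  forall f, Psi (t * f) = Psi t * Psi f.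
Proof.
move=> F2 F3 dM d1 dt D1 Ds PB P1 PW.
have P0 : Psi 0 = 0 by rewrite -(subrr (0 : A)) PB subrr.
have PN x : Psi (- x) = - Psi x by rewrite -sub0r PB P0 sub0r.
have PD x y : Psi (x + y) = Psi x + Psi y by rewrite -[y]opprK PB PN !opprK.
have Pd x : Psi (d x) = D (Psi x).
  by have := PW 1 x; rewrite d1 mulr0 subr0 mul1r P1 D1 mulr0 subr0 mul1r.
have Ptd x : Psi (t * d x) = Psi t * Psi (d x).
  have := PW t x; rewrite dt mulr1 PB Ds mulr1 -Pd => h.
  by rewrite -[LHS](subrK (Psi x)) h subrK.
have dt2 : d (t * t) = t + t by rewrite dM dt mul1r mulr1.
(* Taking [t * t] in [Ptd] gives this identity doubled, and 2 is cancelled in [F]. *)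
have Pt2 : Psi (t * t) = Psi t * Psi t.
  apply: (mulfI F2); rewrite !mulr_natl !mulr2n -PD -mulrDr -mulrDr -PD -dt2.
  exact: Ptd.
move=> f.
have dtf : d (t * f) = f + t * d f by rewrite dM dt mul1r.
have := Ptd (t * f); rewrite dtf mulrDr !PD => e1.
have := PW (t * t) f; rewrite -!Pd dt2 Pt2 PB mulrDr !PD [f * t]mulrC -mulrA => e2.
have e3 := Ptd f.
apply: (mulfI F3); apply/eqP; rewrite -subr_eq0; apply/eqP; move: e1 e2 e3.
move: (Psi (t * (t * d f))) (Psi (t * d f)) (Psi (t * f)) (Psi t) (Psi f)
  (Psi (d f)) => x y z s w v /eqP; rewrite -subr_eq0 => /eqP e1.
move=> /eqP; rewrite -subr_eq0 => /eqP e2 e3; rewrite e3 in e1.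
transitivity ((z + x - s * (w + s * v)) - (x - (z + z) - (s * s * v - w * (s + s)))).
  by ring.
by rewrite e1 e2 subr0.
Qed.

(** The values in K(t) of the elements satisfying [P] form a subalgebra containing the generators,
    hence all of [Ra_set a]. This serves as structural induction on R_a. *)
Lemma Ra_ind (K : fieldType) (a : seq K) (P : Ra a -> Prop) :
    P 1 -> P (tvar a) ->
    (forall x, x \in a -> P (tvar a - x%:A)^-1) ->
    (forall (c : K) f g, P f -> P g -> P (c *: f + g)) ->
    (forall f g, P f -> P g -> P (f * g)) ->
  forall f, P f.
Proof.
move=> P1 Pt PV PZ PM f.
pose S : set (ratfun K) :=
  [set g | exists2 x : Ra a, val x = g & P x]%classic.
suff SR : (Ra_set a `<=` S)%classic.
  have : S (val f) by apply: SR; rewrite -in_setE; exact: valP.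
  by case=> y /val_inj ->.
apply: smallest_sub.
  split=> [|c g h|g h]; rewrite !inE /S /=.
  - by exists 1.
  - by move=> [x <- Px] [y <- Py]; exists (c *: x + y) => //; apply: PZ.
  - by move=> [x <- Px] [y <- Py]; exists (x * y) => //; apply: PM.
move=> g [->|[x ax <-]]; first by exists (tvar a).
exists ((tvar a - x%:A)^-1); last exact: PV.
by have := val_tvarBX (-1) ax; rewrite !exprN1.
Qed.

Lemma Ra_deriv1 (K : fieldType) (a : seq K) : Ra_deriv (1 : Ra a) = 0.
Proof. by apply: val_inj; have := ratderivC (1 : K); rewrite scale1r. Qed.

Lemma Ra_deriv_tvar (K : fieldType) (a : seq K) : Ra_deriv (tvar a) = 1.
Proof. by apply: val_inj; exact: ratderivT. Qed.

Lemma vfield_is_linear (K : fieldType) (a : seq K) : linear (@vfield K a).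
Proof.
move=> c f g; apply: Der_ext => h.
change ((c *: f + g) * Ra_deriv h = c *: (f * Ra_deriv h) + g * Ra_deriv h).
by rewrite mulrDl scalerAl.
Qed.

Lemma vfieldZ (K : fieldType) (a : seq K) (c : K) (f : Ra a) :
  vfield (c *: f) = c *: vfield f.
Proof. by apply: Der_ext => g; exact: (esym (scalerAl c f (Ra_deriv g))). Qed.

Lemma vfield_inj (K : fieldType) (a : seq K) : injective (@vfield K a).
Proof.
move=> f g /(congr1 (fun D : Der (Ra a) => D (tvar a))).
by rewrite !vfieldE Ra_deriv_tvar !mulr1.
Qed.

Lemma val_Ra_scale (K : fieldType) (a : seq K) (c : K) (f : Ra a) :
  val (c *: f) = c *: val f.
Proof. by []. Qed.

(** Computes w (z/w)', with [y] and [x] standing for the derivatives of [z] and [w]. *)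
Fact scaled_quotient_rule (F : fieldType) (w z x y : F) : w != 0 ->
  w * (y * w^-1 + z * - (x * (w^-1 * w^-1))) = (w * y - z * x) / w.
Proof. by move=> w0; field. Qed.

(** With [x] standing for w', the right side is the Wronskian of f/w and g/w for the derivation w
    d/dt. Division by w thus carries one Wronskian to the other. *)
Fact wronskian_quotient_rule (F : fieldType) (w f g x f' g' : F) : w != 0 ->
  (f * g' - g * f') / w =
  f / w * ((w * g' - g * x) / w) - g / w * ((w * f' - f * x) / w).
Proof. by move=> w0; field. Qed.

(* Writing psi (f d/dt) = L f d/dt, u = L 1 and Psi f = L f / u, the derivation
   D = u d/dt of K(t) makes Psi preserve Wronskians, so Psi is multiplicative.
   It maps into R_a' because Psi f = L (f * e) whenever L e = 1. *)
Lemma lie_iso_alg_iso (K : fieldType) (a a' : seq K)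
    (psi : Der (Ra a) -> Der (Ra a')) :
    2%:R != 0 :> K -> 3%:R != 0 :> K -> is_lie_iso psi ->
  exists (phi : {lrmorphism Ra a -> Ra a'}) (u : Ra a'),
    [/\ bijective phi, u * Ra_deriv (phi (tvar a)) = 1
      & forall f, psi (vfield f) = vfield (u * phi f)].
Proof.
move=> K2 K3 [psil psib psiM].
pose L f := psi (vfield f) (tvar a').
have psiE f : psi (vfield f) = vfield (L f) by exact: Der_Ra_vfield.
have Llin : linear L.
  by move=> c f g; apply: vfield_inj; rewrite -psiE !vfield_is_linear psil !psiE.
have Linj : injective L.
  move=> f g Lfg; apply: vfield_inj; apply: (bij_inj psib).
  by rewrite !psiE Lfg.
have Lsurj g : exists f, L f = g.
  have [psi' _ psiK'] := psib; exists (psi' (vfield g) (tvar a)).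
  by apply: vfield_inj; rewrite -psiE -Der_Ra_vfield psiK'.
have LW f g : L (f * Ra_deriv g - g * Ra_deriv f)
    = L f * Ra_deriv (L g) - L g * Ra_deriv (L f).
  by apply: vfield_inj; rewrite -psiE -!vfield_bracket psiM !psiE.
have LD f g : L (f + g) = L f + L g by rewrite -[f]scale1r Llin !scale1r.
have L0 : L 0 = 0 by apply: (addrI (L 0)); rewrite -LD !addr0.
have LZ c f : L (c *: f) = c *: L f by rewrite -[c *: f]addr0 Llin L0 addr0.
have LB f g : L (f - g) = L f - L g by rewrite LD -scaleN1r LZ scaleN1r.
pose u := L 1.
have u0 : val u != 0.
  apply/eqP => u0; have /Linj/eqP : L 1 = L 0 by rewrite L0; exact: val_inj.
  by rewrite oner_eq0.
pose Psi f := val (L f) / val u.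
have PsiK f : val u * Psi f = val (L f) by rewrite mulrC divfK.
pose D (x : ratfun K) := val u * ratderiv x.
have DPsi f : D (Psi f) =
    (val u * ratderiv (val (L f)) - val (L f) * ratderiv (val u)) / val u.
  by rewrite /D /Psi ratderivM ratderivV // scaled_quotient_rule.
have D1 : D 1 = 0.
  by have := ratderivC (1 : K); rewrite scale1r /D => ->; rewrite mulr0.
have natF k : k%:R != 0 :> K -> k%:R != 0 :> ratfun K.
  move=> k0; have -> : k%:R = k%:R%:A :> ratfun K by rewrite scaler_nat.
  by rewrite scaler_eq0 oner_eq0 orbF.
have DPsit : D (Psi (tvar a)) = 1.
  rewrite DPsi; have := LW 1 (tvar a).
  rewrite Ra_deriv1 Ra_deriv_tvar mulr0 subr0 mul1r => /(congr1 val) LW1.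
  by rewrite -[X in X / _]LW1 divff.
have PsiX : forall f, Psi (tvar a * f) = Psi (tvar a) * Psi f.
  apply: (@wronskian_hom_mulX _ _ _ (@Ra_deriv K a) D).
  - exact: natF.
  - exact: natF.
  - exact: Ra_derivM.
  - exact: Ra_deriv1.
  - exact: Ra_deriv_tvar.
  - exact: D1.
  - exact: DPsit.
  - by move=> f g; rewrite /Psi LB rmorphB mulrBl.
  - exact: divff.
  - move=> f g; rewrite !DPsi /Psi LW rmorphB !rmorphM /=.
    exact: wronskian_quotient_rule.
(* [D] kills constants but takes [Psi (tvar a)] to 1, so the latter is not constant. *)
have us0 x : Psi (tvar a) - x%:A != 0.
  apply/eqP => /eqP; rewrite subr_eq0 => /eqP E.
  by have /eqP := DPsit; rewrite E /D ratderivC mulr0 eq_sym oner_eq0.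
have PsiD f g : Psi (f + g) = Psi f + Psi g by rewrite /Psi LD rmorphD mulrDl.
have PsiZ c f : Psi (c *: f) = c *: Psi f by rewrite /Psi LZ val_Ra_scale scalerAl.
have PsiB f g : Psi (f - g) = Psi f - Psi g by rewrite -scaleN1r PsiD PsiZ scaleN1r.
have Psi1 : Psi 1 = 1 by exact: divff.
(* Multiplicativity spreads from t to all of R_a by induction on the first factor; [g] stays general
   because the product case uses the hypotheses at other second factors. *)
have PsiM f : forall g, Psi (f * g) = Psi f * Psi g.
  elim/Ra_ind: f => [g||x ax g|c f h Pf Ph g|f h Pf Ph g].
  - by rewrite Psi1 !mul1r.
  - exact: PsiX.
  (* Multiplying by the nonzero [Psi (tvar a) - x%:A] reduces this to the rule for t. *)
  - have PV h : Psi ((tvar a - x%:A)^-1 * h) = Psi h / (Psi (tvar a) - x%:A).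
      apply: (canRL (mulfK (us0 x))); rewrite mulrC mulrBl mulr_algl -PsiX -PsiZ.
      by rewrite -PsiB -[x *: (_ * _)]mulr_algl -mulrBl mulrA divrr ?mul1r // tvarB_unit.
    by rewrite PV -[in RHS](mulr1 _^-1) PV Psi1 mul1r mulrC.
  - by rewrite mulrDl -scalerAl !PsiD !PsiZ Pf Ph mulrDl scalerAl.
  - by rewrite -mulrA Pf Ph Pf mulrA.
have [e Le] := Lsurj 1.
pose phi f := L (f * e).
have phiE f : val (phi f) = Psi f.
  rewrite -PsiK PsiM mulrCA PsiK Le; exact: mulr1.
have phiL : linear phi by move=> c f g; rewrite /phi mulrDl -scalerAl Llin.
have phiM : monoid_morphism phi.
  split; first by apply: val_inj; rewrite phiE Psi1.
  by move=> f g; apply: val_inj; rewrite rmorphM /= !phiE PsiM.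
pose phiA := GRing.isLinear.Build K (Ra a) (Ra a') _ phi phiL.
pose phiB := GRing.isMonoidMorphism.Build (Ra a) (Ra a') phi phiM.
pose Phi : {lrmorphism Ra a -> Ra a'} := HB.pack phi phiA phiB.
exists Phi, u.
have uphi f : u * phi f = L f.
  by apply: val_inj; rewrite rmorphM /= phiE PsiK.
split; last by move=> f; rewrite psiE uphi.
- have phi_inj : injective phi.
    by move=> f g fg; apply: Linj; rewrite -!uphi fg.
  have phi_surj g : exists f, phi f = g.
    have [f Lf] := Lsurj (u * g); exists f; apply: val_inj.
    by rewrite phiE /Psi Lf rmorphM mulrC mulKf.
  have [inv phiK] := choice phi_surj.
  by exists inv => // f; apply: phi_inj; rewrite phiK.
- by apply: val_inj; rewrite rmorphM rmorph1 /= -DPsit -phiE.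
Qed.

(** * Regular points and units of R_a *)

Local Notation "p %:F" := (@FracField.tofrac _ p).

Lemma val_RaC (K : fieldType) (a : seq K) (c : K) :
  val (c%:A : Ra a) = c%:P%:F.
Proof. exact: mulr1. Qed.

Lemma val_tvarB (K : fieldType) (a : seq K) (x : K) :
  val (tvar a - x%:A) = ('X - x%:P)%:F.
Proof. by rewrite tofracB -(val_RaC _ a). Qed.

Lemma val_horner_tvar (K : fieldType) (a : seq K) (p : {poly K}) :
  val (horner_alg (tvar a) p) = p%:F.
Proof.
elim/poly_ind: p => [|p c IHp]; first by rewrite !rmorph0.
rewrite rmorphD rmorphM /= horner_algX horner_algC tofracD tofracM -IHp.
by rewrite -(val_RaC _ a).
Qed.

(** The generators have denominators 1 or t - y with y in [a], none vanishing at [x], and sums and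
    products only multiply denominators. *)
Lemma Ra_regular_at (K : fieldType) (a : seq K) (x : K) (f : Ra a) :
  x \notin a -> exists p q : {poly K}, q.[x] != 0 /\ val f * q%:F = p%:F.
Proof.
move=> ax; elim/Ra_ind: f => [||y ay|c f g|f g].
- by exists 1, 1; rewrite hornerC oner_neq0 rmorph1 mulr1.
- by exists 'X, 1; rewrite hornerC oner_neq0 rmorph1 mulr1.
- exists 1, ('X - y%:P); rewrite hornerXsubC subr_eq0; split.
    by apply: contraNneq ax => ->.
  by rewrite -(val_tvarB _ a) -val_RaM mulVr ?tvarB_unit // !rmorph1.
- move=> [p [q [q0 fq]]] [p' [q' [q'0 gq]]].
  exists (c *: p * q' + p' * q), (q * q'); rewrite hornerM mulf_neq0 //; split=> //.
  have -> : val (c *: f + g) = c%:P%:F * val f + val g by [].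
  rewrite -mul_polyC tofracD !tofracM -fq -gq mulrDl !mulrA.
  by congr (_ + _); exact: mulrAC.
- move=> [p [q [q0 fq]]] [p' [q' [q'0 gq]]].
  exists (p * p'), (q * q'); rewrite hornerM mulf_neq0 //; split=> //.
  by rewrite val_RaM !tofracM -fq -gq mulrACA.
Qed.

(** For x outside [a], an inverse p/q of t - x regular at x would give q = (t - x) p, so q would
    vanish at x. *)
Lemma tvarB_unitE (K : fieldType) (a : seq K) (x : K) :
  (tvar a - x%:A \is a GRing.unit) = (x \in a).
Proof.
apply/idP/idP => [u|]; last exact: tvarB_unit.
apply/negPn/negP => /(@Ra_regular_at _ _ _ (tvar a - x%:A)^-1)[p [q [qx E]]].
have : q%:F = (('X - x%:P) * p)%:F.
  rewrite tofracM -E mulrA.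
  by rewrite -(val_tvarB _ a) -val_RaM divrr // rmorph1 mul1r.
move/eqP; rewrite tofrac_eq => /eqP Eq.
by move: qx; rewrite Eq hornerM hornerXsubC subrr mul0r eqxx.
Qed.

(** * The image of t is a fractional linear function *)

(** Here [h] is p(A/B) with its denominator cleared. Modulo A - l B one may replace A by l B, which
    turns [h] into p(l) B^N; the induction follows Horner's scheme. *)
Lemma horner_alg_quotient (K : fieldType) (A B p : {poly K}) (l : K)
    (s : ratfun K) : B%:F * s = A%:F ->
  exists N (h : {poly K}),
    (B ^+ N)%:F * horner_alg s p = h%:F
    /\ A - l *: B %| h - p.[l] *: B ^+ N.
Proof.
move=> Bs; elim/poly_ind: p => [|p c [N [h [Eh dh]]]].
  by exists 0, 0; rewrite rmorph0 mulr0 rmorph0 horner0 scale0r subr0 dvdp0.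
exists N.+1, (h * A + c *: B ^+ N.+1); split.
  rewrite rmorphD rmorphM /= horner_algX horner_algC ratfun_scaleE mulr1.
  rewrite tofracD -mul_polyC !tofracM -Bs -Eh exprS tofracM mulrDr.
  congr (_ + _); last exact: mulrC.
  move: (horner_alg s p) (B ^+ N)%:F B%:F => x y z.
  by rewrite [z * y]mulrC mulrACA mulrA.
rewrite hornerD hornerM hornerX hornerC.
have -> : h * A + c *: B ^+ N.+1 - (p.[l] * l + c) *: B ^+ N.+1
    = (h - p.[l] *: B ^+ N) * A + p.[l] *: B ^+ N * (A - l *: B).
  by rewrite exprS -!mul_polyC polyCD polyCM; ring.
by apply: dvdp_add; [exact: dvdp_mulr | exact/dvdp_mull/dvdpp].
Qed.

Lemma rmorph_horner_alg (K : fieldType) (A B : algType K)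
    (g : {rmorphism A -> B}) (x : A) (p : {poly K}) :
  (forall c : K, g c%:A = c%:A) -> g (horner_alg x p) = horner_alg (g x) p.
Proof.
move=> gC; elim/poly_ind: p => [|p c IHp]; first by rewrite !rmorph0.
by rewrite !(rmorphD, rmorphM) /= !horner_algX !horner_algC IHp gC.
Qed.

Fact clear_denominators (F : comNzRingType) (x y b bN bM t s q p l : F) :
  t * x * q - x * p = y * (s - l) ->
  bN * x * (q * t - p) * (bM * b) = bM * y * (b * s - l * b) * bN.
Proof.
move=> E; transitivity (bN * (t * x * q - x * p) * (bM * b)); first by ring.
by rewrite E; ring.
Qed.

(* Put t' = P(s)/Q(s) with s = A/B.  Modulo A - l B one has s = l, so A - l B
   divides Q(l) t' - P(l), which is linear; two values of l bound A and B. *)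
Lemma quotient_generator_degree (K : closedFieldType) (A B P Q : {poly K})
    (s : ratfun K) :
    B != 0 -> coprimep A B -> B%:F * s = A%:F -> Q != 0 ->
    ratT * horner_alg s Q = horner_alg s P ->
  (size A <= 2)%N /\ (size B <= 2)%N.
Proof.
move=> B0 AB Bs Q0 PQ.
have size_pencil l : Q.[l] != 0 -> (size (A - l *: B)%R <= 2)%N.
  move=> Ql; set D := A - l *: B.
  (* The left side vanishes at [l]. Evaluated at s, where P(s) = t Q(s), it becomes Q(s) (Q(l) t -
     P(l)), so this factor is tied to s - l = D/B. *)
  have [G EG] : exists G, P * Q.[l]%:P - Q * P.[l]%:P = G * ('X - l%:P).
    by apply/factor_theorem; rewrite rootE !hornerE mulrC subrr.
  have [N [q [Eq dq]]] := horner_alg_quotient _ A B Q l s Bs.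
  have [M [g [Eg _]]] := horner_alg_quotient _ A B G l s Bs.
  have E : q * (Q.[l] *: 'X - P.[l]%:P) * (B ^+ M * B) = g * D * B ^+ N.
    apply/eqP; rewrite -tofrac_eq; apply/eqP.
    have := congr1 (horner_alg s) EG.
    rewrite !(rmorphB, rmorphM) /= horner_algX !horner_algC -PQ !ratfun_scaleE !mulr1.
    rewrite /D -!mul_polyC !(tofracM, tofracB) -Eq -Eg -Bs.
    exact: clear_denominators.
  have DB : coprimep D B.
    by rewrite coprimep_sym /D addrC -scaleNr -mul_polyC coprimep_addl_mul coprimep_sym.
  (* Modulo [D], [q] is Q(l) B^N, with Q(l) nonzero and B coprime to [D]. *)
  have Dq : coprimep D q.
    have /dvdpP[k qE] := dq; rewrite -[q](subrK (Q.[l] *: B ^+ N)) qE.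
    by rewrite coprimep_addl_mul coprimepZr // coprimep_expr.
  have : D %| Q.[l] *: 'X - P.[l]%:P.
    rewrite -(Gauss_dvdpr _ Dq) -(@Gauss_dvdpl _ _ (B ^+ M * B)).
      by rewrite E dvdp_mulr ?dvdp_mulIr.
    by rewrite coprimepMr coprimep_expr.
  have sz : size (Q.[l] *: 'X - P.[l]%:P)%R = 2%N.
    rewrite size_polyDl size_scale ?size_polyX // size_polyN.
    by rewrite size_polyC; case: eqP.
  by move/dvdp_leq; rewrite sz -size_poly_eq0 sz; apply.
(* Two distinct values avoiding the roots of [Q]: their pencils A - l1 B and A - l2 B span both A
   and B. *)
have [l1 Ql1] := closed_nonrootP _ Q0.
have [l2] : exists l2, ~~ root (Q * ('X - l1%:P)) l2.
  by apply/closed_nonrootP; rewrite mulf_neq0 // polyXsubC_eq0.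
rewrite rootM root_XsubC negb_or rootE => /andP[Ql2 l21].
have sz1 := size_pencil _ Ql1; have sz2 := size_pencil _ Ql2.
have szB : (size B <= 2)%N.
  have -> : B = (l2 - l1)^-1 *: ((A - l1 *: B) - (A - l2 *: B)).
    rewrite opprB [X in _ *: X]addrC addrA subrK -scalerBl scalerA.
    by rewrite mulVf ?scale1r ?subr_eq0.
  rewrite (leq_trans (size_scale_leq _ _)) // (leq_trans (size_polyD _ _)) //.
  by rewrite size_polyN geq_max sz1 sz2.
split=> //; rewrite -[A](subrK (l1 *: B)) (leq_trans (size_polyD _ _)) //.
by rewrite geq_max sz1 (leq_trans (size_scale_leq _ _)).
Qed.

(** Let A/B be s = phi(t) in lowest terms and f = P/Q. Since phi commutes with evaluating
    polynomials, phi(f) = t reads t Q(s) = P(s), so s generates K(t) and the degree bound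
    applies. *)
Lemma alg_hom_fractional_linear (K : closedFieldType) (a a' : seq K)
    (phi : {lrmorphism Ra a -> Ra a'}) (f : Ra a) : phi f = tvar a' ->
  exists A B : {poly K}, [/\ B != 0, (size A <= 2)%N, (size B <= 2)%N
    & B%:F * val (phi (tvar a)) = A%:F].
Proof.
move=> phif; set s := phi (tvar a).
have [P [Q [Q0 valf]]] := ratfun_split (val f).
have [p [q [q0 sE]]] := ratfun_split (val s).
have g0 : gcdp p q != 0 by rewrite gcdp_eq0 negb_and q0 orbT.
pose A := p %/ gcdp p q; pose B := q %/ gcdp p q.
have pE : p = A * gcdp p q by rewrite divpK ?dvdp_gcdl.
have qE : q = B * gcdp p q by rewrite divpK ?dvdp_gcdr.
have B0 : B != 0 by apply: contraNneq q0 => B0; rewrite qE B0 mul0r.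
have Bs : B%:F * val s = A%:F.
  rewrite sE [in LHS]pE {2}qE; move: (gcdp p q) g0 => g g0.
  rewrite !tofracM -mulf_div divff ?tofrac_eq0 // mulr1.
  by rewrite mulrC divfK ?tofrac_eq0.
exists A, B; suff [] : (size A <= 2)%N /\ (size B <= 2)%N by [].
apply: (quotient_generator_degree _ _ _ P Q (val s)) => //.
  by rewrite coprimep_div_gcd ?q0 ?orbT.
have fE : f * horner_alg (tvar a) Q = horner_alg (tvar a) P.
  by apply: val_inj; rewrite val_RaM !val_horner_tvar valf divfK ?tofrac_eq0.
have : phi f * phi (horner_alg (tvar a) Q) = phi (horner_alg (tvar a) P).
  by rewrite -rmorphM fE.
have val_phi p' : val (phi (horner_alg (tvar a) p')) = horner_alg (val s) p'.
  rewrite rmorph_horner_alg => [|c]; last exact: rmorph_alg.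
  exact: rmorph_horner_alg.
by move/(congr1 val); rewrite phif val_RaM !val_phi.
Qed.

Lemma poly_size2 (K : fieldType) (p : {poly K}) :
  (size p <= 2)%N -> p = p`_1 *: 'X + (p`_0)%:P.
Proof.
move=> sp; apply/polyP => -[|[|i]]; rewrite !coefE ?mulr0 ?mulr1 ?add0r ?addr0 //.
by rewrite nth_default // (leq_trans sp).
Qed.

Lemma Ra_derivC (K : fieldType) (a : seq K) (c : K) : Ra_deriv (c%:A : Ra a) = 0.
Proof. by rewrite Ra_derivZ Ra_deriv1 scaler0. Qed.

Lemma Ra_deriv_tvarB (K : fieldType) (a : seq K) (x : K) :
  Ra_deriv (tvar a - x%:A) = 1.
Proof. by rewrite -scaleNr Ra_derivD Ra_derivC addr0 Ra_deriv_tvar. Qed.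

(** The cases are a constant and a nonconstant denominator, that is, whether s fixes infinity. The
    nonzero derivative rules out a constant s, hence [al = 0] and [c = 0]. *)
Lemma fractional_linear_cases (K : closedFieldType) (a : seq K) (s : Ra a)
    (A B : {poly K}) :
    B != 0 -> (size A <= 2)%N -> (size B <= 2)%N -> B%:F * val s = A%:F ->
    Ra_deriv s != 0 ->
  (exists al be : K, al != 0 /\ s = al *: tvar a + be%:A) \/
  (exists x z c : K, c != 0 /\ (s - x%:A) * (tvar a - z%:A) = c%:A).
Proof.
move=> B0 sA sB Bs ds0.
have {}Bs : horner_alg (tvar a) B * s = horner_alg (tvar a) A.
  by apply: val_inj; rewrite val_RaM !val_horner_tvar.
move: B0 Bs; rewrite (poly_size2 _ A sA) (poly_size2 _ B sB).
move: (A`_1) (A`_0) (B`_1) (B`_0) => p q r v.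
rewrite !rmorphD /= !linearZ /= !horner_algX !horner_algC !mulr_algl.
have [->|r0] := eqVneq r 0.
  rewrite !scale0r !add0r polyC_eq0 /= => v0.
  rewrite mulr_algl => /(congr1 (fun y => v^-1 *: y)) /=.
  rewrite scalerA mulVf // scale1r.
  rewrite scalerDr !scalerA => sE; left; exists (v^-1 * p), (v^-1 * q); split=> //.
  by apply: contraNneq ds0 => E; rewrite sE E scale0r add0r Ra_derivC.
(* For s = (p t + q)/(r t + v), these are the value at infinity, the pole, and the coefficient of
   1/(t - z) in s. *)
move=> _ E; right; exists (p / r), (- v / r), ((q - p / r * v) / r).
have main : (s - (p / r)%:A) * (tvar a - (- v / r)%:A) = ((q - p / r * v) / r)%:A.
  have -> : tvar a - (- v / r)%:A = r^-1 *: (r *: tvar a + v%:A).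
    by rewrite scalerDr !scalerA mulVf // scale1r mulNr scaleNr opprK mulrC.
  rewrite -scalerAr mulrBl [s * _]mulrC E mulr_algl [(p / r) *: _]scalerDr !scalerA.
  by rewrite divfK // opprD addrACA subrr add0r -scalerBl scalerA [r^-1 * _]mulrC.
split=> //; apply: contraNneq ds0 => c0; move: main; rewrite c0 scale0r.
move=> /(congr1 val)/eqP; rewrite val_RaM mulf_eq0 (negbTE (ratT_neqC _)) orbF.
move=> /eqP sx; suff -> : s = (p / r)%:A by rewrite Ra_derivC.
by apply/eqP; rewrite -subr_eq0; apply/eqP; apply: val_inj.
Qed.

(** * Units and integer powers under inversion *)

Lemma bij_rmorph_unit (R S : unitRingType) (f : {rmorphism R -> S}) (x : R) :
  bijective f -> (f x \is a GRing.unit) = (x \is a GRing.unit).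
Proof.
move=> fbij; apply/idP/idP => [/unitrP[y [yf fy]]|]; last exact: rmorph_unit.
have [g fK gK] := fbij; apply/unitrP; exists (g y).
by split; apply: (can_inj fK); rewrite rmorphM rmorph1 gK.
Qed.

Lemma exprZz (K : fieldType) (A : unitAlgType K) (c : K) (x : A) (k : int) :
  c != 0 -> x \is a GRing.unit -> (c *: x) ^ k = c ^ k *: x ^ k.
Proof.
move=> c0 ux; rewrite -mulr_algl exprMz_comm //.
- by rewrite -(fmorphXz (in_alg A)) mulr_algl.
- by rewrite scaler_unit ?unitr1 ?unitfE.
- by rewrite /GRing.comm mulr_algl mulr_algr.
Qed.

Section InversionFormulas.
Variables (K : fieldType) (A : comUnitAlgType K) (c : K) (y : A).
Hypotheses (c0 : c != 0) (uy : y \is a GRing.unit).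

Lemma exprz_subr2 (k : int) : (y ^ (k - 2))^-1 = y ^+ 2 * (y^-1) ^ k.
Proof. by rewrite invr_expz opprB exprzDr // exprz_inv -exprnP. Qed.

(** With y = t - z, the factor [- c^-1 *: y ^+ 2] is the image of d/dt when infinity is moved, and
    [c *: y^-1] is the image of t - x0. The next lemma treats the other poles, with d = x0 - x. *)
Lemma inversion_pole_power (k : int) :
  (- c^-1 *: y ^+ 2) * (c *: y^-1) ^ k = - (c ^ (k - 1)) *: (y ^ (k - 2))^-1.
Proof.
rewrite exprZz ?unitrV // exprz_subr2 -scalerAl -scalerAr scalerA mulNr.
by rewrite [_^-1 * _]mulrC -exprN1 -expfzDr.
Qed.

Lemma inversion_regular_power (d : K) (v : A) (k : int) :
    d != 0 -> v \is a GRing.unit ->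
  (- c^-1 *: y ^+ 2) * (d *: (v / y)) ^ k
    = - (d ^ k) *: v ^ k / (c *: y ^ (k - 2)).
Proof.
move=> d0 uv; rewrite exprZz ?unitrMl ?unitrV //.
rewrite exprMz_comm ?unitrV //; last exact: mulrC.
rewrite invrZ ?unitfE ?unitrXz // exprz_subr2 -!scalerAl -!scalerAr !scalerA.
by rewrite !mulNr [c^-1 * _]mulrC mulrCA.
Qed.

End InversionFormulas.

(** * The action on poles and on powers of t - x *)

(** The dichotomy with poles described by membership, before any ordering. Comparing units among the
    t - x on both sides locates the poles; [u] is found by differentiating the formula for
    phi(t). *)
Lemma lie_iso_points (K : closedFieldType) (a a' : seq K)
    (psi : Der (Ra a) -> Der (Ra a')) :
    2%:R != 0 :> K -> 3%:R != 0 :> K -> is_lie_iso psi ->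
  (exists al be : K, [/\ al != 0,
      forall x, ((x - be) / al \in a') = (x \in a)
    & forall (k : int) x, x \in a ->
      psi (vfield ((tvar a - x%:A) ^ k))
      = al ^ (k - 1) *: vfield ((tvar a' - ((x - be) / al)%:A) ^ k)])
  \/ (exists x0 z c : K, [/\ c != 0, x0 \in a, z \in a',
      forall x, x != x0 -> (z + c / (x - x0) \in a') = (x \in a)
    & forall k : int,
      psi (vfield ((tvar a - x0%:A) ^ k))
      = vfield (- (c ^ (k - 1)) *: ((tvar a' - z%:A) ^ (k - 2))^-1)
      /\ forall x, x \in a -> x != x0 ->
        psi (vfield ((tvar a - x%:A) ^ k))
        = vfield (- ((x0 - x) ^ k) *: (tvar a' - (z + c / (x - x0))%:A) ^ k
                  / (c *: (tvar a' - z%:A) ^ (k - 2)))]).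
Proof.
move=> K2 K3 /(lie_iso_alg_iso _ _ _ _ K2 K3)[phi [u [phib us psiE]]].
have [phi' _ phiK'] := phib.
have [A [B [B0 sA sB Bs]]] := alg_hom_fractional_linear _ _ _ phi _ (phiK' (tvar a')).
have unitE x : (phi (tvar a - x%:A) \is a GRing.unit) = (x \in a).
  by rewrite bij_rmorph_unit // tvarB_unitE.
have phiB x : phi (tvar a - x%:A) = phi (tvar a) - x%:A.
  by rewrite rmorphB; congr (_ - _); exact: rmorph_alg.
have phiX x (k : int) : x \in a ->
    psi (vfield ((tvar a - x%:A) ^ k)) = vfield (u * phi (tvar a - x%:A) ^ k).
  by move=> ax; rewrite psiE rmorphXz // tvarB_unit.
have ds0 : Ra_deriv (phi (tvar a)) != 0.
  by apply/eqP => ds0; move/eqP: us; rewrite ds0 mulr0 eq_sym oner_eq0.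
have [[al [be [al0 sE]]]|[x0 [z [c [c0 sE]]]]] :=
  fractional_linear_cases _ _ _ A B B0 sA sB Bs ds0; [left|right].
  have phiE x : phi (tvar a - x%:A) = al *: (tvar a' - ((x - be) / al)%:A).
    rewrite phiB sE scalerBr scalerA mulrCA divff // mulr1 scalerBl opprB.
    by rewrite addrA.
  exists al, be; split=> // [x|k x ax].
    by rewrite -unitE phiE scaler_unit ?unitfE // tvarB_unitE.
  have uy : tvar a' - ((x - be) / al)%:A \is a GRing.unit.
    by rewrite -(@scaler_unit _ _ al) ?unitfE // -phiE unitE.
  have ual : al *: u = 1.
    move: us; rewrite sE Ra_derivD Ra_derivZ Ra_derivC addr0 Ra_deriv_tvar.
    by rewrite mulr_algr.
  have uE : u = al^-1%:A by rewrite -ual scalerA mulVf // scale1r.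
  rewrite phiX // uE phiE exprZz // mulr_algl scalerA mulrC -exprN1 -expfzDr //.
  exact: vfieldZ.
(* The relation (phi(t) - x0)(t - z) = c exhibits the inverse. *)
have uz : tvar a' - z%:A \is a GRing.unit.
  apply/unitrPr; exists (c^-1 *: (phi (tvar a) - x0%:A)).
  by rewrite -scalerAr mulrC sE scalerA mulVf // scale1r.
have phi0 : phi (tvar a - x0%:A) = c *: (tvar a' - z%:A)^-1.
  by rewrite phiB -[RHS]mulr_algl -sE mulrK.
have phiE x : x != x0 -> phi (tvar a - x%:A)
    = (x0 - x) *: ((tvar a' - (z + c / (x - x0))%:A) / (tvar a' - z%:A)).
  move=> xx0; have x0x : x0 - x != 0 by rewrite subr_eq0 eq_sym.
  rewrite scalerAl [(z + _)%:A]scalerDl opprD addrA [(x0 - x) *: _]scalerBr scalerA.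
  have -> : (x0 - x) * (c / (x - x0)) = - c.
    by rewrite -opprB mulNr mulrCA divff ?mulr1 // subr_eq0.
  rewrite scaleNr opprK mulrDl -scalerAl divrr // mulr_algl -phi0 !phiB.
  by rewrite scalerBl [RHS]addrC addrA subrK.
(* Differentiating (phi(t) - x0)(t - z) = c and multiplying by u gives (t - z) + u (phi(t) - x0) =
   0, where phi(t) - x0 = c/(t - z). *)
have uE : u = - c^-1 *: (tvar a' - z%:A) ^+ 2.
  have := congr1 (@Ra_deriv K a') sE.
  rewrite Ra_derivM Ra_deriv_tvarB mulr1 Ra_derivC -scaleNr Ra_derivD Ra_derivC addr0.
  move/(congr1 (fun f => u * f)); rewrite mulr0 mulrDr mulrA us mul1r scaleNr => E.
  have {}E : u * (phi (tvar a) - x0%:A) = - (tvar a' - z%:A).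
    by apply/eqP; rewrite -addr_eq0 addrC E.
  rewrite expr2 scaleNr -scalerN -mulrN -E -phiB phi0 mulrCA -scalerAr divrr //.
  by rewrite -scalerAr scalerA mulVf // scale1r mulr1.
have ax0 : x0 \in a by rewrite -unitE phi0 scaler_unit ?unitfE // unitrV.
have mem_a' x : x != x0 -> (z + c / (x - x0) \in a') = (x \in a).
  move=> xx0; rewrite -unitE phiE // scaler_unit ?unitfE ?subr_eq0 1?eq_sym //.
  by rewrite unitrMl ?unitrV // tvarB_unitE.
exists x0, z, c; split=> //; first by rewrite -tvarB_unitE.
move=> k; split=> [|x ax xx0].
  by rewrite phiX // phi0 uE inversion_pole_power.
rewrite phiX // phiE // uE; congr vfield.
apply: inversion_regular_power => //; first by rewrite subr_eq0 eq_sym.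
by apply: tvarB_unit; rewrite mem_a'.
Qed.

(** * Ordering the poles *)

Theorem theorem7 (R : realType) (n m : nat) (hn : (0 < n)%N) (hm : (0 < m)%N)
    (a : n.-tuple R[i]) (a' : m.-tuple R[i])
    (ha : uniq a) (ha' : uniq a')
    (psi : Der (Ra a) -> Der (Ra a')) (hpsi : is_lie_iso psi) :
  m = n /\
  ((exists (c : R[i]) (b' : n.-tuple R[i]),
     [/\ c != 0,
         perm_eq b' a',
         forall i : nat, (i < n)%N -> a`_i - a`_0 = c * (b'`_i - b'`_0)
       & forall (k : int) (i : nat), (i < n)%N ->
           psi (vfield ((tvar a - (a`_i)%:A) ^ k)) =
           c ^ (k - 1) *: vfield ((tvar a' - (b'`_i)%:A) ^ k)])
   \/
   (exists (c : R[i]) (b b' : n.-tuple R[i]),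
     [/\ c != 0,
         perm_eq b a /\ perm_eq b' a',
         forall i : nat, (0 < i < n)%N ->
           (b`_i - b`_0) * (b'`_i - b'`_0) = c
       & forall k : int,
           psi (vfield ((tvar a - (b`_0)%:A) ^ k)) =
             vfield (- (c ^ (k - 1)) *: ((tvar a' - (b'`_0)%:A) ^ (k - 2))^-1)
           /\ forall i : nat, (0 < i < n)%N ->
             psi (vfield ((tvar a - (b`_i)%:A) ^ k)) =
             vfield (- ((b`_0 - b`_i) ^ k) *: (tvar a' - (b'`_i)%:A) ^ k
                     / (c *: (tvar a' - (b'`_0)%:A) ^ (k - 2)))])).
Proof.
have natK k : k.+1%:R != 0 :> R[i] by rewrite pnatr_eq0.
have sa : size a = n by rewrite size_tuple.
have sa' : size a' = m by rewrite size_tuple.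
case: (lie_iso_points _ _ _ psi (natK 1) (natK 2) hpsi).
(* Infinity is fixed: the affine map [f] sends [a] onto [a'], so [a'] is reordered as the image of
   [a], and c is [al]. *)
- move=> [al [be [al0 mem_a' psiE]]]; pose f x := (x - be) / al.
  have f_inj : injective f.
    by move=> x y /(mulIf (invr_neq0 al0))/addIr.
  have pa' : perm_eq (map_tuple f a) a'.
    apply: uniq_perm => //=; first by rewrite map_inj_uniq.
    move=> y; apply/mapP/idP => [[x ax ->]|a'y]; first by rewrite mem_a'.
    have fy : y = f (y * al + be) by rewrite /f addrK mulfK.
    by exists (y * al + be) => //; rewrite -mem_a' -[_ / _]fy.
  split; first by rewrite -sa' -(perm_size pa') size_tuple.
  left; exists al, (map_tuple f a); split=> // [i ltin|k i ltin].
    rewrite !(nth_map 0) ?sa // /f -mulrBl mulrCA divff // mulr1.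
    by rewrite opprB addrA subrK.
  by rewrite (nth_map 0) ?sa // psiE // mem_nth ?sa.
- move=> [x0 [z [c [c0 ax0 a'z mem_a' psiE]]]]; pose f x := z + c / (x - x0).
  (* The pole [x0], sent to infinity, and the pole [z], coming from infinity, are put first; [f]
     matches the remaining ones. *)
  pose b := x0 :: rem x0 a; pose b' := z :: map f (rem x0 a).
  have pb : perm_eq b a by rewrite perm_sym perm_to_rem.
  have mem_r x : (x \in rem x0 a) = (x != x0) && (x \in a) by rewrite mem_rem_uniq.
  have f_inj : {in rem x0 a &, injective f}.
    move=> x y _ _ /addrI /(mulfI c0) /invr_inj /addIr; exact.
  have fz x : x != x0 -> f x != z.
    move=> xx0; rewrite -subr_eq0 /f addrC addKr mulf_neq0 ?invr_eq0 //.
    by rewrite subr_eq0.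
  have pb' : perm_eq b' a'.
    apply: uniq_perm => //=.
      rewrite map_inj_in_uniq // rem_uniq // andbT; apply/mapP => -[x].
      by rewrite mem_r => /andP[/fz xx0 _] zE; rewrite -zE eqxx in xx0.
    move=> y; rewrite inE; have [->|yz] := eqVneq y z; first by rewrite a'z.
    have yz0 : y - z != 0 by rewrite subr_eq0.
    apply/mapP/idP => [[x]|a'y].
      by rewrite mem_r => /andP[xx0 ax] ->; rewrite mem_a'.
    (* The point x0 + c/(y - z) solves (x - x0)(y - z) = c for x, so it is the preimage of y under
       [f]. *)
    have xx0 : x0 + c / (y - z) != x0.
      by rewrite -subr_eq0 addrC addKr mulf_neq0 ?invr_eq0.
    have fy : y = f (x0 + c / (y - z)).
      by rewrite /f [x0 + _]addrC addrK invf_div mulrCA divff // mulr1 addrC subrK.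
    exists (x0 + c / (y - z)) => //.
    by rewrite mem_r xx0 -mem_a' // -[z + _]fy.
  have sb : size b == n by rewrite (perm_size pb) sa.
  have sb' : size b' == n by rewrite -(eqP sb) /= size_map.
  split; first by rewrite -sa' -(perm_size pb') (eqP sb').
  have nth_b i : (0 < i < n)%N ->
      [/\ b`_i != x0, b`_i \in a & b'`_i = f b`_i].
    case: i => // i /= ltin; have lti : (i < size (rem x0 a))%N.
      by rewrite -ltnS (eqP sb : (size (rem x0 a)).+1 = n).
    have /andP[bx0 ab] : ((rem x0 a)`_i != x0) && ((rem x0 a)`_i \in a).
      by rewrite -mem_r mem_nth.
    by split=> //; rewrite (nth_map 0).
  right; exists c, (Tuple sb), (Tuple sb'); split=> // [i /nth_b[bx0 _ /= ->]|k].
    by rewrite /f [z + _]addrC addrK mulrCA divff ?mulr1 ?subr_eq0.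
  have [psi0 psiX] := psiE k; split=> // i /nth_b[bx0 ab /= ->].
  exact: psiX.
Qed.
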